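(* Let $I$ be a finite interval and let $\psi$ be a monotone function in $\mathrm{VMO}(I)$. Then the function $t\mapsto t^2\xi_\psi^2(t)$ is convex on $[0,|I|]$.
   Context: All intervals are finite and of positive length; $|J|$ is Lebesgue measure and $\langle f\rangle_J=\frac1{|J|}\int_J f$. $\mathrm{VMO}(I)$ is the space of functions of vanishing mean oscillation on $I$: (equivalently) all real-valued $\varphi\in L^2(I)$ such that $\sup\{\langle\varphi^2\rangle_J-\langle\varphi\rangle_J^2\colon J\subset I \text{ a subinterval},\ 0<|J|\le\varepsilon\}\to0$ as $\varepsilon\to0^+$. For $\varphi\in\mathrm{VMO}(I)$ define $\xi_\varphi\colon[0,|I|]\to[0,\infty)$ by $\xi_\varphi(0)=0$ and $$\xi_\varphi(t)=\sup\Big\{\big(\langle\varphi^2\rangle_J-\langle\varphi\rangle_J^2\big)^{1/2}\colon J\subset I \text{ a subinterval},\ 0<|J|\le t\Big\},\qquad 0<t\le|I|.$$ *)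

(* Defs.v *)
From HB Require Import structures.
From mathcomp Require Import all_boot all_order all_algebra.
From mathcomp Require Import all_classical all_reals all_analysis.

Set Implicit Arguments.
Unset Strict Implicit.
Unset Printing Implicit Defensive.

Import Order.TTheory GRing.Theory Num.Theory.
Import numFieldNormedType.Exports.

Local Open Scope classical_set_scope.
Local Open Scope ring_scope.

Section VMO.
Context {R : realType}.
Implicit Types (I J : set R) (phi : R -> R) (t : R).

Local Notation mu := (@lebesgue_measure R).

(* The endpoints may or may not belong to the interval. *)
Definition finite_interval I : Prop :=
  [/\ is_interval I, (0 < mu I)%E & (mu I < +oo)%E].

Definition length I : R := fine (mu I).

Definition mean phi J : R := (\int[mu]_(x in J) phi x) / length J.

Definition mean_var phi J : R :=
  mean (fun x => phi x ^+ 2) J - mean phi J ^+ 2.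

Definition subintervals I t : set (set R) :=
  [set J | [/\ finite_interval J, J `<=` I & length J <= t]].

Definition square_integrable I phi : Prop :=
  measurable_fun I phi /\ mu.-integrable I (fun x => (phi x ^+ 2)%:E).

(* Functions are total on R, but only their values on I matter. The supremum is
   taken in \bar R because the real [sup] of an unbounded set is 0. *)
Definition VMO I phi : Prop :=
  square_integrable I phi /\
  ereal_sup [set (mean_var phi J)%:E | J in subintervals I eps]
    @[eps --> 0^'+] --> 0%E.

(* For phi in VMO I the set below is bounded, so that [sup] is the genuine
   supremum. *)
Definition xi I phi t : R :=
  if t == 0 then 0
  else sup [set Num.sqrt (mean_var phi J) | J in subintervals I t].

Definition monotone_on I phi : Prop :=
  {in I &, nondecreasing_fun phi} \/ {in I &, nonincreasing_fun phi}.

End VMO.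

(* Main.v *)
Require Import Defs.
From HB Require Import structures.
From mathcomp Require Import all_boot all_order all_algebra.
From mathcomp Require Import all_classical all_reals all_analysis.
From mathcomp Require Import measurable_realfun ring lra.

Import Order.TTheory GRing.Theory Num.Theory.
Import numFieldNormedType.Exports.

Local Open Scope classical_set_scope.
Local Open Scope ring_scope.

(** Write V(J) = |J|^2 Var_J(psi) = |J| int_J psi^2 - (int_J psi)^2 and
    F(t) = t^2 xi(t)^2. Since V(J) is the double integral of
    (psi(x) - psi(y))^2 over pairs x < y in J, lengthening J = [a, b] at its
    right end costs V the rate B = int_J (psi(b) - psi)^2, and at its left end
    the rate A = int_J (psi(a) - psi)^2. For monotone psi these rates grow when
    J grows, so V is convex in each endpoint. Hence c = min (A, B) supports F
    from below at J:

      F(s) >= V(J) + c (s - |J|)   for every s in [0, |I|].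

    For s < |J| the interval is shortened at the end where the rate is c; for
    s > |J| it is lengthened at whichever ends have room, at rates that are all
    at least c ([spread_support]). When J already touches one end of I, only
    the other end can move, and the rate there plays the role of c for both
    directions.

    The supremum in xi(t) runs over |J| <= t, so J gives in addition
    F(s) >= Var_J(psi) s^2 for s >= |J|. At a point t >= |J| between s1 and s2,
    either c is at most the slope 2 t Var_J(psi) of this parabola, and the
    tangent of the parabola at t lies below F at s1 and s2, or c exceeds that
    slope, and the supporting line lies above the parabola at t
    ([three_points]). In both cases the chord of F lies above t^2 Var_J(psi),
    and the supremum over J gives convexity.

    All computations with V rest on one identity for disjoint sets,
    V(J u K) = V(J) + V(K) + int_K int_J (psi(y) - psi(x))^2 dx dy
    ([spread_setU]). The inner integral is a quadratic polynomial in psi(y), so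
    only one-dimensional integrals of psi and psi^2 occur. Vanishing mean
    oscillation serves to make the variances bounded, so that the supremum in
    xi is a genuine one. *)

(** * Bounded intervals and their endpoints *)

Section BoundedIntervals.
Context {R : realType}.

Local Notation mu := (@lebesgue_measure R).

Lemma itvoo_sub_itvcc (a b c d : R) : a < b ->
  `]a, b[ `<=` `[c, d] -> c <= a /\ b <= d.
Proof.
move=> ab sub.
have subP z : a < z -> z < b -> c <= z <= d.
  by move=> az zb; have := sub z; rewrite /= !in_itv /= az zb => /(_ isT).
split; rewrite leNgt; apply/negP => h.
- have [cb|bc] := leP c b.
    have /andP[] : c <= (a + c) / 2 <= d by apply: subP; lra.
    by lra.
  have /andP[] : c <= (a + b) / 2 <= d by apply: subP; lra.
  by lra.
- have [ad|da] := leP a d.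
    have /andP[] : c <= (b + d) / 2 <= d by apply: subP; lra.
    by lra.
  have /andP[] : c <= (a + b) / 2 <= d by apply: subP; lra.
  by lra.
Qed.

Lemma finite_interval_endpoints (J : set R) : finite_interval J ->
  exists a b : R, [/\ a < b, `]a, b[ `<=` J & J `<=` `[a, b]].
Proof.
move=> [/is_intervalP JE]; set i := Rhull J in JE.
have {JE} -> : J = [set` i] by [].
rewrite lebesgue_measure_itv; case: i => [[x a|[|]] [y b|[|]]] //=;
  rewrite ?ltxx ?ltry ?ltNyr //.
rewrite lte_fin; case: ifP => [ab _ _|]; last by rewrite ltxx.
exists a, b; split => //.
- by move=> z; case: x y => [] []; rewrite /= !in_itv /= => /andP[az zb];
    rewrite ?(ltW az) ?(ltW zb) ?az ?zb.
- by move=> z; case: x y => [] []; rewrite /= !in_itv /= => /andP[az zb];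
    rewrite ?(ltW az) ?(ltW zb) ?az ?zb.
Qed.

Lemma measure_between_endpoints (J : set R) (a b : R) : measurable J ->
  a <= b -> `]a, b[ `<=` J -> J `<=` `[a, b] -> mu J = (b - a)%:E.
Proof.
move=> mJ ab abJ Jab; apply/eqP; rewrite eq_le; apply/andP; split.
  have -> : (b - a)%:E = mu `[a, b].
    rewrite lebesgue_measure_itv /= lte_fin; case: ltP => // ba.
    by rewrite (@le_anti _ _ a b) ?ab ?ba // subrr.
  by apply: le_measure => //; rewrite inE.
have -> : (b - a)%:E = mu `]a, b[.
  rewrite lebesgue_measure_itv /= lte_fin; case: ltP => // ba.
  by rewrite (@le_anti _ _ a b) ?ab ?ba // subrr.
by apply: le_measure => //; rewrite inE.
Qed.

Lemma finite_interval_between (J : set R) (a b : R) : is_interval J ->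
  a < b -> `]a, b[ `<=` J -> J `<=` `[a, b] -> finite_interval J.
Proof.
move=> iJ ab abJ Jab; split => //;
  rewrite (measure_between_endpoints _ _ _ _ (ltW ab) abJ Jab) ?ltry //;
  try exact: is_interval_measurable.
by rewrite lte_fin subr_gt0.
Qed.

(** An integral does not see which endpoints a set contains: they form a null
    set. This reduces the four kinds of intervals to a single one. *)
Lemma Rintegral_between_endpoints (J : set R) (a b : R) (f : R -> R) :
  measurable J -> mu.-integrable J (EFin \o f) ->
  `]a, b[ `<=` J -> J `<=` `[a, b] ->
  \int[mu]_(x in J) f x = \int[mu]_(x in `]a, b[) f x.
Proof.
move=> mJ fJ abJ Jab; rewrite /Rintegral.
have -> : `]a, b[%classic = J `\` [set a; b].
  apply/seteqP; split=> x /=.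
    move=> xab; split; first exact: abJ.
    by move: xab; rewrite in_itv /= => /andP[ax xb] [] E; move: ax xb; rewrite E ltxx.
  move=> [/Jab /=]; rewrite !in_itv /= => /andP[ax xb] nab.
  rewrite !lt_neqAle ax xb !andbT; apply/andP; split; apply/eqP => E; apply: nab.
    by left.
  by right.
congr fine; apply: negligible_integral => //.
  by apply: measurableU; exact: measurable_set1.
apply: countable_lebesgue_measure0.
by apply: finite_set_countable; exact: finite_set2.
Qed.

Lemma length_gt0 (J : set R) : finite_interval J -> 0 < length J.
Proof. by move=> [_ J0 Joo]; rewrite /length fine_gt0 // J0. Qed.

End BoundedIntervals.

(** * An inequality for three points *)

(** Here m is a variance over an interval of length r, c a supporting slope
    there, and F1, F2 are values at s1 and s2 of the function to be shown
    convex. The slope 2 m t of the parabola m s^2 at t decides between two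
    affine minorants: its tangent at t, or the supporting line. *)
Lemma three_points (R : realType) (m c r s1 s2 t p F1 F2 : R) :
  0 <= m -> 0 <= r -> 0 <= p -> p <= 1 -> t = p * s1 + (1 - p) * s2 ->
  s1 <= r -> r <= t ->
  m * r ^+ 2 + c * (s1 - r) <= F1 -> m * r ^+ 2 + c * (s2 - r) <= F2 ->
  m * s2 ^+ 2 <= F2 ->
  m * t ^+ 2 <= p * F1 + (1 - p) * F2.
Proof.
move=> m0 r0 p0 p1 tE s1r rt F1l F2l F2q.
have q0 : 0 <= 1 - p by lra.
(* The tangent at t is below the parabola, hence below the supporting line at
   r; being at least as steep, it stays below that line on the left of r. *)
have [ck|kc] := leP c (2 * m * t).
  have T1 : m * t ^+ 2 + 2 * m * t * (s1 - t) <= F1.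
    apply: le_trans F1l.
    have h1 : 0 <= (2 * m * t - c) * (r - s1) by apply: mulr_ge0; lra.
    have h2 : 0 <= m * (t - r) ^+ 2 by apply: mulr_ge0 => //; exact: sqr_ge0.
    by nra.
  have T2 : m * t ^+ 2 + 2 * m * t * (s2 - t) <= F2.
    apply: le_trans F2q.
    have h2 : 0 <= m * (t - s2) ^+ 2 by apply: mulr_ge0 => //; exact: sqr_ge0.
    by nra.
  apply: le_trans (lerD (ler_wpM2l p0 T1) (ler_wpM2l q0 T2)).
  by rewrite le_eqVlt; apply/orP; left; apply/eqP; rewrite tE; ring.
(* The slope c exceeds that of the parabola on [r, t], so the line, which meets
   the parabola at r, is above it at t. *)
apply: le_trans (lerD (ler_wpM2l p0 F1l) (ler_wpM2l q0 F2l)).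
have -> : p * (m * r ^+ 2 + c * (s1 - r)) + (1 - p) * (m * r ^+ 2 + c * (s2 - r))
    = m * r ^+ 2 + c * (t - r) by rewrite tE; ring.
have h1 : 0 <= (c - 2 * m * t) * (t - r) by apply: mulr_ge0; lra.
have h2 : 0 <= m * (t - r) ^+ 2 by apply: mulr_ge0 => //; exact: sqr_ge0.
by nra.
Qed.

(** * Spread and square deviation *)

Section Spread.
Context {R : realType} (I : set R) (psi : R -> R).
Context (hI : finite_interval I) (hL2 : square_integrable I psi).
Implicit Types (J K M : set R) (v w : R).

Local Notation mu := (@lebesgue_measure R).

Let psi2 x := psi x ^+ 2.

(** The variance times the squared length; it is half the integral of
    (psi x - psi y)^2 over the square of J. *)
Definition spread J : R :=
  length J * (\int[mu]_(x in J) psi2 x) - (\int[mu]_(x in J) psi x) ^+ 2.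

(** At the value v taken by psi at an endpoint of J, this is the rate at which
    [spread] grows when J is lengthened there. *)
Definition sqdev J v : R := \int[mu]_(x in J) (v - psi x) ^+ 2.

(** The sets over which psi and its square are integrable. *)
Definition part J := measurable J /\ J `<=` I.

Lemma measurable_I : measurable I.
Proof. by case: hI => /is_interval_measurable. Qed.

Lemma measure_part J : part J -> (mu J < +oo)%E.
Proof.
case: hI => _ _ Ioo [mJ JI]; apply: le_lt_trans Ioo.
by apply: le_measure => //; rewrite inE //; exact: measurable_I.
Qed.

Lemma integrable_cst_part J v : part J -> mu.-integrable J (EFin \o cst v).
Proof.
move=> pJ; apply: measurable_bounded_integrable => //.
- by case: pJ.
- exact: measure_part.
- exists `|v|; split; first exact: num_real.
  by move=> M /ltW vM x _ /=.
Qed.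

Lemma integrable_sqr_part J : part J -> mu.-integrable J (EFin \o psi2).
Proof.
case=> mJ JI; case: hL2 => _ i2.
by apply: (integrableS _ _ _ i2) => //; exact: measurable_I.
Qed.

Lemma integrable_part J : part J -> mu.-integrable J (EFin \o psi).
Proof.
move=> pJ; have [mJ JI] := pJ.
apply: (@le_integrable _ _ _ mu J mJ _ (fun x => (psi2 x + 1)%:E)).
- apply/measurable_EFinP; case: hL2 => mpsi _.
  exact: measurable_funS measurable_I JI mpsi.
- move=> x _ /=; rewrite lee_fin /psi2.
  rewrite [leRHS]ger0_norm ?addr_ge0 ?sqr_ge0//.
  rewrite ler_norml; apply/andP; split; nra.
- apply: (@integrableD _ _ _ mu J mJ (fun x => (psi2 x)%:E) (fun=> 1%:E)).
    exact: integrable_sqr_part.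
  exact: (integrable_cst_part _ 1).
Qed.

Lemma integrable_quad J (a b c : R) : part J ->
  mu.-integrable J (EFin \o (fun x => a * psi2 x + b * psi x + c)).
Proof.
move=> pJ; have [mJ JI] := pJ.
apply: (@integrableD _ _ _ mu J mJ (fun x => (a * psi2 x + b * psi x)%:E)
  (fun=> c%:E)); last exact: integrable_cst_part.
apply: (@integrableD _ _ _ mu J mJ (fun x => (a * psi2 x)%:E)
  (fun x => (b * psi x)%:E)).
  exact: (@integrableZl _ _ _ mu J mJ a) (integrable_sqr_part _ pJ).
exact: (@integrableZl _ _ _ mu J mJ b) (integrable_part _ pJ).
Qed.

(** [sqdev] and its integrals in v are integrals of quadratic polynomials in
    psi, hence determined by the length and the first two moments. *)
Lemma Rintegral_quad J (a b c : R) : part J ->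
  \int[mu]_(x in J) (a * psi2 x + b * psi x + c) =
  a * (\int[mu]_(x in J) psi2 x) + b * (\int[mu]_(x in J) psi x)
    + c * length J.
Proof.
move=> pJ; have [mJ JI] := pJ.
have i2 := integrable_sqr_part _ pJ; have i1 := integrable_part _ pJ.
have ia : mu.-integrable J (EFin \o (fun x => a * psi2 x)).
  exact: (@integrableZl _ _ _ mu J mJ a _ i2).
have ib : mu.-integrable J (EFin \o (fun x => b * psi x)).
  exact: (@integrableZl _ _ _ mu J mJ b _ i1).
have iab : mu.-integrable J (EFin \o (fun x => a * psi2 x + b * psi x)).
  exact: (@integrableD _ _ _ mu J mJ (fun x => (a * psi2 x)%:E)
    (fun x => (b * psi x)%:E) ia ib).
rewrite RintegralD //; last exact: integrable_cst_part.
by rewrite RintegralD // !RintegralZl // Rintegral_cst.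
Qed.

Lemma sqdevE J v : part J ->
  sqdev J v = v ^+ 2 * length J - 2 * v * (\int[mu]_(x in J) psi x)
    + \int[mu]_(x in J) psi2 x.
Proof.
move=> pJ; rewrite /sqdev.
transitivity (\int[mu]_(x in J) (1 * psi2 x + (- 2 * v) * psi x + v ^+ 2)).
  by apply: eq_Rintegral => x _; rewrite /psi2; ring.
by rewrite Rintegral_quad //; ring.
Qed.

Lemma integrable_sqdev J v : part J ->
  mu.-integrable J (EFin \o (fun x => (v - psi x) ^+ 2)).
Proof.
move=> pJ; have [mJ _] := pJ.
apply: (eq_integrable _ _ _ _ (integrable_quad _ 1 (- 2 * v) (v ^+ 2) pJ)) => //.
by move=> x _ /=; congr EFin; rewrite /psi2; ring.
Qed.

Lemma le_sqdev J v w : part J ->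
  (forall x, J x -> (v - psi x) ^+ 2 <= (w - psi x) ^+ 2) ->
  sqdev J v <= sqdev J w.
Proof.
by move=> pJ vw; case: (pJ) => mJ _; apply: le_Rintegral => //;
  exact: integrable_sqdev.
Qed.

Lemma sqdev_ge0 J v : 0 <= sqdev J v.
Proof. by apply: Rintegral_ge0 => x _; rewrite sqr_ge0. Qed.

Lemma Rintegral_sqdev J K : part J -> part K ->
  \int[mu]_(y in K) sqdev J (psi y) =
  length J * (\int[mu]_(x in K) psi2 x)
  - 2 * (\int[mu]_(x in J) psi x) * (\int[mu]_(x in K) psi x)
  + (\int[mu]_(x in J) psi2 x) * length K.
Proof.
move=> pJ pK; rewrite -mulNr -Rintegral_quad //.
by apply: eq_Rintegral => y _; rewrite sqdevE // /psi2; ring.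
Qed.

Lemma integrable_sqdev_psi J K : part J -> part K ->
  mu.-integrable K (EFin \o (fun y => sqdev J (psi y))).
Proof.
move=> pJ pK; have [mK _] := pK.
apply: (eq_integrable _ _ _ _ (integrable_quad _ (length J)
  (- (2 * (\int[mu]_(x in J) psi x))) (\int[mu]_(x in J) psi2 x) pK)) => //.
by move=> y _ /=; congr EFin; rewrite sqdevE // /psi2; ring.
Qed.

(** The integral over y in J of the square deviations from psi y is twice the
    spread, and it is nonnegative; dividing by the length is avoided, so null
    sets need no separate case. *)
Lemma spread_ge0 J : part J -> 0 <= spread J.
Proof.
move=> pJ.
have : 0 <= \int[mu]_(y in J) sqdev J (psi y).
  by apply: Rintegral_ge0 => y _; exact: sqdev_ge0.
by rewrite Rintegral_sqdev // /spread => h; nra.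
Qed.

Lemma part_setU J K : part J -> part K -> part (J `|` K).
Proof.
move=> [mJ JI] [mK KI]; split; first exact: measurableU.
by rewrite subUset.
Qed.

Lemma length_setU J K : part J -> part K -> [disjoint J & K] ->
  length (J `|` K) = length J + length K.
Proof.
move=> pJ pK JK; have pU := part_setU _ _ pJ pK.
have E M : part M -> length M = \int[mu]_(x in M) (cst 1 x).
  by case=> mM _; rewrite Rintegral_cst // mul1r.
case: (pJ) (pK) => mJ _ [mK _].
by rewrite !E // Rintegral_setU //; exact: integrable_cst_part.
Qed.

Lemma sqdev_setU J K v : part J -> part K -> [disjoint J & K] ->
  sqdev (J `|` K) v = sqdev J v + sqdev K v.
Proof.
move=> pJ pK JK; case: (pJ) (pK) => mJ _ [mK _].
by rewrite /sqdev Rintegral_setU //; apply: integrable_sqdev; exact: part_setU.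
Qed.

(** Splitting the double integral of (psi x - psi y)^2 over J u K: pairs in J,
    pairs in K, and mixed pairs. *)
Lemma spread_setU J K : part J -> part K -> [disjoint J & K] ->
  spread (J `|` K) =
  spread J + spread K + \int[mu]_(y in K) sqdev J (psi y).
Proof.
move=> pJ pK JK; have pU := part_setU _ _ pJ pK.
case: (pJ) (pK) => mJ _ [mK _].
rewrite Rintegral_sqdev // /spread length_setU // !Rintegral_setU //.
- by ring.
- exact: integrable_part.
- exact: integrable_sqr_part.
Qed.

Lemma spread_extend J K w : part J -> part K -> [disjoint J & K] ->
  (forall y, K y -> w <= sqdev J (psi y)) ->
  spread J + length K * w <= spread (J `|` K).
Proof.
move=> pJ pK JK wle; rewrite spread_setU //.
have := spread_ge0 _ pK; suff : length K * w <= \int[mu]_(y in K) sqdev J (psi y).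
  by lra.
case: (pK) => mK _; rewrite mulrC -Rintegral_cst //.
by apply: le_Rintegral => //; [exact: integrable_cst_part|exact: integrable_sqdev_psi].
Qed.

(** The mean minimizes the square deviation: the difference of the two sides
    is the square of v |J| - int_J psi. *)
Lemma spread_le_sqdev J v : part J -> spread J <= length J * sqdev J v.
Proof.
move=> pJ; rewrite sqdevE // /spread -subr_ge0.
rewrite [leRHS](_ : _ = (v * length J - \int[mu]_(x in J) psi x) ^+ 2).
  exact: sqr_ge0.
by ring.
Qed.

(** The bound involves the square deviation over the larger set, since
    removing K also removes the pairs inside K; by [spread_le_sqdev] these cost
    at most |K| times the square deviation over K. *)
Lemma spread_shrink J K v : part J -> part K -> [disjoint J & K] ->
  (forall y, K y -> sqdev J (psi y) <= sqdev J v) ->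
  spread (J `|` K) <= spread J + length K * sqdev (J `|` K) v.
Proof.
move=> pJ pK JK lev; rewrite spread_setU // sqdev_setU //.
rewrite -addrA lerD2l mulrDr addrC lerD //; last exact: spread_le_sqdev.
case: (pK) => mK _; rewrite mulrC -Rintegral_cst //.
by apply: le_Rintegral => //; [exact: integrable_sqdev_psi|exact: integrable_cst_part].
Qed.

Lemma spread_between_endpoints (J K : set R) (a b : R) : part J -> part K ->
  a <= b -> `]a, b[ `<=` J -> J `<=` `[a, b] ->
  `]a, b[ `<=` K -> K `<=` `[a, b] -> spread J = spread K.
Proof.
move=> pJ pK ab abJ Jab abK Kab; have [mJ _] := pJ; have [mK _] := pK.
have i2J := integrable_sqr_part _ pJ; have i2K := integrable_sqr_part _ pK.
have i1J := integrable_part _ pJ; have i1K := integrable_part _ pK.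
rewrite /spread /length !(measure_between_endpoints _ _ _ mJ ab abJ Jab)
  !(measure_between_endpoints _ _ _ mK ab abK Kab).
by rewrite !(Rintegral_between_endpoints J a b) // !(Rintegral_between_endpoints K a b).
Qed.

(** * Moving the endpoints of an interval *)

Context (L U : R) (LU : L < U) (LUI : `]L, U[ `<=` I) (ILU : I `<=` `[L, U]).
(* Monotonicity enters only through this property, shared by nondecreasing and
   nonincreasing functions and invariant under reflection of the line. *)
Context (betw : forall x y z, I x -> I y -> I z -> x <= y -> y <= z ->
  (psi x - psi y) ^+ 2 <= (psi x - psi z) ^+ 2 /\
  (psi y - psi z) ^+ 2 <= (psi x - psi z) ^+ 2).

(** Half-open intervals split into half-open intervals without overlap or gap,
    and an interval with equal endpoints is empty; the intersection with I
    matters when an endpoint of I is missing from I. *)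
Definition piece (a b : R) : set R := `[a, b[ `&` I.

Lemma in_I x : L < x -> x < U -> I x.
Proof. by move=> Lx xU; apply: LUI; rewrite /= in_itv /= Lx. Qed.

Lemma pieceP a b x : piece a b x -> [/\ a <= x, x < b & I x].
Proof. by rewrite /piece /= in_itv /= => -[/andP[]]. Qed.

Lemma part_piece a b : part (piece a b).
Proof.
split; last exact: subIsetr.
by apply: measurableI => //; exact: measurable_I.
Qed.

Lemma piece_itv a b : piece a b `<=` `[a, b].
Proof. by move=> x /pieceP[ax xb _]; rewrite /= in_itv /= ax ltW. Qed.

Lemma itv_piece a b : L <= a -> b <= U -> `]a, b[ `<=` piece a b.
Proof.
move=> La bU x; rewrite /= in_itv /= => /andP[ax xb].
split; first by rewrite /= in_itv /= xb ltW.
by apply: in_I; [exact: le_lt_trans ax|exact: lt_le_trans xb _].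
Qed.

Lemma length_piece a b : L <= a -> a <= b -> b <= U -> length (piece a b) = b - a.
Proof.
move=> La ab bU; have [mp _] := part_piece a b.
by rewrite /length (measure_between_endpoints _ _ _ mp ab) //;
  [exact: itv_piece|exact: piece_itv].
Qed.

Lemma is_interval_I : is_interval I. Proof. by case: hI. Qed.

Lemma finite_interval_piece a b : L <= a -> a < b -> b <= U ->
  finite_interval (piece a b).
Proof.
move=> La ab bU; apply: (finite_interval_between _ a b) => //.
- move=> x y /pieceP[ax _ Ix] /pieceP[_ yb Iy] z /andP[xz zy]; split.
    by rewrite /= in_itv /= (le_trans ax xz) (le_lt_trans zy).
  by apply: is_interval_I Ix Iy _ _; rewrite xz.
- exact: itv_piece.
- exact: piece_itv.
Qed.

Lemma pieceU a b c : a <= b -> b <= c -> piece a c = piece a b `|` piece b c.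
Proof.
move=> ab bc; rewrite /piece -setIUl; congr (_ `&` _).
by apply: itv_bndbnd_setU; rewrite bnd_simp.
Qed.

Lemma disj_piece a b c : [disjoint piece a b & piece b c].
Proof.
apply/disj_setPS => x [/pieceP[_ xb _] /pieceP[bx _ _]].
by move: (lt_le_trans xb bx); rewrite ltxx.
Qed.

Lemma disj_piece' a b c : [disjoint piece b c & piece a b].
Proof. by rewrite disj_set_sym; exact: disj_piece. Qed.

(** By monotonicity, points beyond b are farther in value from those of the
    piece than b is. The slope w is arbitrary below the rate at b so that the
    extensions at both ends can share the same slope. *)
Lemma extend_right a b b' w : L <= a -> a <= b -> b <= b' -> b' <= U -> I b ->
  w <= sqdev (piece a b) (psi b) ->
  spread (piece a b) + (b' - b) * w <= spread (piece a b').
Proof.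
move=> La ab bb' b'U Ib wB; rewrite (pieceU a b b') //.
rewrite -(length_piece b b') ?(le_trans La) //.
apply: spread_extend; try exact: part_piece; first exact: disj_piece.
move=> y /pieceP[by_ _ Iy]; apply: le_trans wB _; apply: le_sqdev.
  exact: part_piece.
move=> x /pieceP[_ xb Ix]; rewrite -[leLHS]sqrrN -[leRHS]sqrrN !opprB.
by have [] := betw x b y Ix Ib Iy (ltW xb) by_.
Qed.

Lemma extend_left a a' b w : L <= a' -> a' <= a -> a <= b -> b <= U -> I a ->
  w <= sqdev (piece a b) (psi a) ->
  spread (piece a b) + (a - a') * w <= spread (piece a' b).
Proof.
move=> La' a'a ab bU Ia wA; rewrite (pieceU a' a b) // setUC.
rewrite -(length_piece a' a) ?(le_trans ab) //.
apply: spread_extend; try exact: part_piece; first exact: disj_piece'.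
move=> y /pieceP[_ ya Iy]; apply: le_trans wA _; apply: le_sqdev.
  exact: part_piece.
move=> x /pieceP[ax _ Ix].
by have [] := betw y a x Iy Ia Ix (ltW ya) ax.
Qed.

Lemma shrink_right a b b0 : L <= a -> a <= b0 -> b0 <= b -> b <= U -> I b ->
  spread (piece a b) <=
  spread (piece a b0) + (b - b0) * sqdev (piece a b) (psi b).
Proof.
move=> La ab0 b0b bU Ib; rewrite (pieceU a b0 b) //.
rewrite -(length_piece b0 b) ?(le_trans La) //.
apply: spread_shrink; try exact: part_piece; first exact: disj_piece.
move=> y /pieceP[b0y yb Iy]; apply: le_sqdev; first exact: part_piece.
move=> x /pieceP[_ xb0 Ix]; have xy : x <= y by move: b0y; lra.
rewrite -[leLHS]sqrrN -[leRHS]sqrrN !opprB.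
by have [] := betw x y b Ix Iy Ib xy (ltW yb).
Qed.

Lemma shrink_left a a0 b : L <= a -> a <= a0 -> a0 <= b -> b <= U -> I a ->
  spread (piece a b) <=
  spread (piece a0 b) + (a0 - a) * sqdev (piece a b) (psi a).
Proof.
move=> La aa0 a0b bU Ia; rewrite (pieceU a a0 b) // setUC.
rewrite -(length_piece a a0) ?(le_trans a0b) //.
apply: spread_shrink; try exact: part_piece; first exact: disj_piece'.
move=> y /pieceP[ay ya0 Iy]; apply: le_sqdev; first exact: part_piece.
move=> x /pieceP[a0x _ Ix]; have yx : y <= x by move: ya0; lra.
by have [] := betw a y x Ia Iy Ix ay yx.
Qed.

Lemma sqdev_piece_le a b b' v : a <= b -> b <= b' ->
  sqdev (piece a b) v <= sqdev (piece a b') v.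
Proof.
move=> ab bb'; rewrite (pieceU a b b') // sqdev_setU; try exact: part_piece.
  by rewrite lerDl; exact: sqdev_ge0.
exact: disj_piece.
Qed.

(** The supporting slope c is the smaller of the rates at the two ends, or the
    rate at the only end that can still move. Lengthening first to the right
    and then to the left keeps the rates at least c, because the rate at the
    left end increases with the piece ([sqdev_piece_le]). *)
Lemma spread_support a b s1 s2 : L <= a -> a < b -> b <= U ->
  0 <= s1 -> s1 <= b - a -> b - a <= s2 -> s2 <= U - L -> b - a < U - L ->
  exists c a1 b1 a2 b2,
    [/\ [/\ L <= a1, a1 <= b1, b1 <= U, b1 - a1 = s1 &
            spread (piece a b) + c * (s1 - (b - a)) <= spread (piece a1 b1)] &
        [/\ L <= a2, a2 <= b2, b2 <= U, b2 - a2 = s2 &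
            spread (piece a b) + c * (s2 - (b - a)) <= spread (piece a2 b2)]].
Proof.
move=> La ab bU s10 s1r rs2 s2UL rUL.
set V := spread (piece a b).
set A := sqdev (piece a b) (psi a); set B := sqdev (piece a b) (psi b).
have Ia : L < a -> I a by move=> ?; apply: in_I => //; lra.
have Ib : b < U -> I b by move=> ?; apply: in_I => //; lra.
have shrinkA : L < a -> V + A * (s1 - (b - a)) <= spread (piece (b - s1) b).
  move=> /Ia ?; have : V <= spread (piece (b - s1) b) + ((b - s1) - a) * A.
    by apply: shrink_left => //; lra.
  by lra.
have shrinkB : b < U -> V + B * (s1 - (b - a)) <= spread (piece a (a + s1)).
  move=> /Ib ?; have : V <= spread (piece a (a + s1)) + (b - (a + s1)) * B.
    by apply: shrink_right => //; lra.
  by lra.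
have extA d w : L < a -> 0 <= d -> L <= a - d -> w <= A ->
    V + d * w <= spread (piece (a - d) b).
  move=> /Ia ? d0 Lad wA; have {1}-> : d = a - (a - d) by ring.
  by apply: extend_left => //; lra.
have extB d w : b < U -> 0 <= d -> b + d <= U -> w <= B ->
    V + d * w <= spread (piece a (b + d)).
  move=> /Ib ? d0 Lad wA; have {1}-> : d = (b + d) - b by ring.
  by apply: extend_right => //; lra.
have extAB w : L < a -> b < U -> w <= A -> w <= B -> exists a2 b2,
    [/\ L <= a2, a2 <= b2, b2 <= U, b2 - a2 = s2 &
        V + w * (s2 - (b - a)) <= spread (piece a2 b2)].
  move=> La' bU' wA wB.
  have [s2U|Us2] := leP (a + s2) U.
    exists a, (b + (s2 - (b - a))); split; try lra.
    by rewrite mulrC; apply: extB => //; lra.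
  (* No room for the whole extension on the right: b moves to U, then a. *)
  exists (U - s2), (b + (U - b)); split; try lra.
  have := extB (U - b) w bU' ltac:(lra) ltac:(lra) wB.
  have bUe : b + (U - b) = U by ring.
  rewrite bUe => h1.
  have h2 : spread (piece a U) + (a - (U - s2)) * w <= spread (piece (U - s2) U).
    apply: extend_left => //; try lra; first exact: Ia.
    by apply: le_trans wA _; apply: sqdev_piece_le; lra.
  apply: le_trans h2; apply: le_trans (lerD h1 (lexx _)).
  by rewrite le_eqVlt; apply/orP; left; apply/eqP; ring.
have [La'|aL] := ltP L a; last first.
  have bU' : b < U by lra.
  exists B, a, (a + s1), a, (b + (s2 - (b - a))); split; split; try lra.
  by rewrite mulrC; apply: extB => //; lra.
have [bU'|Ub] := ltP b U; last first.
  exists A, (b - s1), b, (a - (s2 - (b - a))), b; split; split; try lra.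
  by rewrite mulrC; apply: extA => //; lra.
have [AB|/ltW BA] := leP A B.
  have [a2 [b2 ext]] := extAB A La' bU' (lexx _) AB.
  by exists A, (b - s1), b, a2, b2; split=> //; split; lra.
have [a2 [b2 ext]] := extAB B La' bU' BA (lexx _).
by exists B, a, (a + s1), a2, b2; split=> //; split; lra.
Qed.

(** * The function xi *)

Lemma length_I : length I = U - L.
Proof.
by rewrite /length (measure_between_endpoints I _ _ measurable_I (ltW LU)).
Qed.

Lemma finite_interval_part (J : set R) : finite_interval J -> J `<=` I -> part J.
Proof. by move=> [iJ _ _] JI; split=> //; exact: is_interval_measurable. Qed.

Lemma mean_varE (J : set R) : finite_interval J ->
  mean_var psi J = spread J / length J ^+ 2.
Proof.
move=> /length_gt0 l0; rewrite /mean_var /mean /spread /psi2.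
by field; rewrite gt_eqF.
Qed.

Lemma mean_var_ge0 (J : set R) : finite_interval J -> J `<=` I ->
  0 <= mean_var psi J.
Proof.
move=> fJ JI; rewrite mean_varE // divr_ge0 ?sqr_ge0 //.
by apply: spread_ge0; exact: finite_interval_part.
Qed.

(** Short intervals have variance below 1 by vanishing mean oscillation; on an
    interval longer than e the variance is at most int_I psi^2 / e. *)
Lemma mean_var_bounded : VMO I psi ->
  exists C : R, forall J, finite_interval J -> J `<=` I -> mean_var psi J <= C.
Proof.
move=> [_ cv0].
have lt1 : \forall e \near 0^'+, (ereal_sup
    [set (mean_var psi J)%:E | J in subintervals I e] < 1%:E)%E.
  exact: (cv0 _ (@nbhs_open_ereal_lt R 0 (fun=> 1) ltr01)).
have [e [e0 supe]] : exists e : R, 0 < e /\ (ereal_sup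
    [set (mean_var psi J)%:E | J in subintervals I e] < 1%:E)%E.
  near (0 : R)^'+ => e; exists e; split; first by near: e; exact: nbhs_right_gt.
  by near: e.
set S2 := \int[mu]_(x in I) psi2 x.
have S20 : 0 <= S2 by apply: Rintegral_ge0 => x _; exact: sqr_ge0.
exists (1 + S2 / e) => J fJ JI.
have [Je|eJ] := leP (length J) e.
  apply: (@le_trans _ _ 1); last by rewrite lerDl divr_ge0 // ltW.
  rewrite -lee_fin; apply: le_trans (ltW supe).
  by apply: ereal_sup_ubound; exists J.
have pJ := finite_interval_part _ fJ JI; have [mJ _] := pJ.
apply: (@le_trans _ _ (S2 / e)); last by rewrite lerDr.
apply: (@le_trans _ _ (mean (fun x => psi x ^+ 2) J)).
  by rewrite /mean_var gerBl sqr_ge0.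
have JS2 : \int[mu]_(x in J) psi2 x <= S2.
  have pK : part (I `\` J).
    by split; [apply: measurableD => //; exact: measurable_I|exact: subDsetl].
  have IE : I = J `|` (I `\` J) by rewrite setDUK.
  rewrite /S2 [in leRHS]IE Rintegral_setU //.
  - by rewrite lerDl; apply: Rintegral_ge0 => x _; exact: sqr_ge0.
  - by case: pK.
  - by apply: integrable_sqr_part; exact: part_setU.
  - by apply/disj_setPS => x [] ? [].
rewrite /mean ler_pM // ?invr_ge0 ?(ltW (length_gt0 _ fJ)) //.
  by apply: Rintegral_ge0 => x _; exact: sqr_ge0.
by rewrite lef_pV2 ?posrE ?(ltW eJ) ?length_gt0.
Unshelve. all: by end_near.
Qed.

Lemma mean_var_le_xi (J : set R) s : VMO I psi -> finite_interval J -> J `<=` I ->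
  length J <= s -> mean_var psi J <= xi I psi s ^+ 2.
Proof.
move=> /mean_var_bounded[C leC] fJ JI Js.
have s0 : 0 < s by exact: lt_le_trans (length_gt0 _ fJ) Js.
rewrite /xi gt_eqF // -[leLHS]sqr_sqrtr ?mean_var_ge0 //.
have lesup : Num.sqrt (mean_var psi J) <=
    sup [set Num.sqrt (mean_var psi K) | K in subintervals I s].
  apply: ub_le_sup; last by exists J.
  exists (Num.sqrt C) => _ [K [fK KI _] <-].
  by apply: ler_wsqrtr; exact: leC.
by rewrite ler_pXn2r // ?nnegrE ?sqrtr_ge0 // (le_trans _ lesup) ?sqrtr_ge0.
Qed.

Lemma sqr_xi_le s X : 0 < s -> 0 <= X ->
  (forall J, finite_interval J -> J `<=` I -> length J <= s ->
    mean_var psi J <= X) -> xi I psi s ^+ 2 <= X.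
Proof.
move=> s0 X0 leX; rewrite /xi gt_eqF //.
set S := [set _ | _ in _].
have [->|/set0P S0] := eqVneq S set0; first by rewrite sup0 expr0n.
have supX : sup S <= Num.sqrt X.
  apply: ge_sup => // _ [J [fJ JI Js] <-].
  by apply: ler_wsqrtr; exact: leX.
have sup0' : 0 <= sup S.
  case: S0 => x Sx; apply: (@le_trans _ _ x).
    by case: Sx => J _ <-; exact: sqrtr_ge0.
  apply: ub_le_sup => //; exists (Num.sqrt X) => _ [J [fJ JI Js] <-].
  by apply: ler_wsqrtr; exact: leX.
rewrite -[leRHS]sqr_sqrtr //.
by rewrite ler_pXn2r // ?nnegrE ?sqrtr_ge0.
Qed.

(** Every interval J with |J| <= t gives a lower bound for the chord at t. If
    |J| <= s1 the parabola alone suffices; if J exhausts I then t = s2; in the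
    remaining case the supporting line of [spread_support] is available. *)
Lemma scaled_xi_convex s1 s2 t p : VMO I psi ->
  0 <= s1 -> s1 <= s2 -> s2 <= U - L -> 0 <= p -> p <= 1 ->
  t = p * s1 + (1 - p) * s2 ->
  t ^+ 2 * xi I psi t ^+ 2 <=
  p * (s1 ^+ 2 * xi I psi s1 ^+ 2) + (1 - p) * (s2 ^+ 2 * xi I psi s2 ^+ 2).
Proof.
move=> vmo s10 s12 s2UL p0 p1 tE.
have q0 : 0 <= 1 - p by lra.
have t1 : s1 <= t.
  have : 0 <= (1 - p) * (s2 - s1) by apply: mulr_ge0; lra.
  by rewrite tE; lra.
have t2 : t <= s2.
  have : 0 <= p * (s2 - s1) by apply: mulr_ge0; lra.
  by rewrite tE; lra.
set F1 := s1 ^+ 2 * _; set F2 := s2 ^+ 2 * _.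
have F10 : 0 <= F1 by rewrite mulr_ge0 ?sqr_ge0.
have F20 : 0 <= F2 by rewrite mulr_ge0 ?sqr_ge0.
have FF0 : 0 <= p * F1 + (1 - p) * F2 by apply: addr_ge0; exact: mulr_ge0.
have [t_eq0|t_neq0] := eqVneq t 0; first by rewrite t_eq0 expr0n mul0r.
have t0 : 0 < t by rewrite lt_neqAle eq_sym t_neq0 (le_trans s10).
rewrite mulrC -ler_pdivlMr ?exprn_gt0 //.
apply: sqr_xi_le => // [|J fJ JI Jt]; first by rewrite divr_ge0 ?sqr_ge0.
rewrite ler_pdivlMr ?exprn_gt0 //.
have m0 := mean_var_ge0 _ fJ JI; set m := mean_var psi J in m0 *.
have r0 := length_gt0 _ fJ.
have F2q : m * s2 ^+ 2 <= F2.
  rewrite mulrC ler_wpM2l ?sqr_ge0 //.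
  by apply: mean_var_le_xi => //; exact: le_trans t2.
have [Js1|s1J] := leP (length J) s1.
  have F1q : m * s1 ^+ 2 <= F1.
    rewrite mulrC ler_wpM2l ?sqr_ge0 //.
    exact: mean_var_le_xi.
  (* The parabola itself supplies the supporting line, its tangent at s1. *)
  apply: (three_points _ _ (2 * m * s1) s1 s1 s2) => //; first by lra.
  apply: le_trans F2q.
  have h2 : 0 <= m * (s1 - s2) ^+ 2 by apply: mulr_ge0 => //; exact: sqr_ge0.
  by nra.
have [a [b [ab abJ Jab]]] := finite_interval_endpoints _ fJ.
have pJ := finite_interval_part _ fJ JI.
have JE : length J = b - a.
  by rewrite /length (measure_between_endpoints _ _ _ pJ.1 (ltW ab)).
have [La bU] := itvoo_sub_itvcc _ _ _ _ ab (subset_trans abJ (subset_trans JI ILU)).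
have spE : spread J = spread (piece a b).
  apply: (spread_between_endpoints _ _ a b) => //; try exact: ltW.
  - exact: part_piece.
  - exact: itv_piece.
  - exact: piece_itv.
have mE : m * length J ^+ 2 = spread (piece a b).
  by rewrite /m mean_varE // divfK ?spE // expf_neq0 // gt_eqF.
have Fle a' b' : L <= a' -> a' <= b' -> b' <= U ->
    spread (piece a' b') <= (b' - a') ^+ 2 * xi I psi (b' - a') ^+ 2.
  move=> La'; rewrite le_eqVlt => /orP[/eqP <- a'U|ab' b'U].
    rewrite subrr expr0n mul0r /spread length_piece // subrr mul0r sub0r.
    by rewrite oppr_le0 sqr_ge0.
  have fp := finite_interval_piece _ _ La' ab' b'U.
  have lp : length (piece a' b') = b' - a' by apply: length_piece => //; exact: ltW.
  have := mean_var_le_xi _ (b' - a') vmo fp (@subIsetr _ _ _).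
  rewrite lp lexx mean_varE // lp => /(_ isT).
  by rewrite ler_pdivrMr ?exprn_gt0 ?subr_gt0 // mulrC.
have [UL|ULne] := leP (U - L) (b - a).
  have ts2 : t = s2 by lra.
  have : p * (s2 - s1) = 0 by rewrite mulrBr; lra.
  move/eqP; rewrite mulf_eq0 => /orP[/eqP p0'|]; last by rewrite gt_eqF //; lra.
  by rewrite p0' mul0r add0r subr0 mul1r ts2.
have [c [a1 [b1 [a2 [b2 [[La1 ab1 b1U E1 G1] [La2 ab2 b2U E2 G2]]]]]]] :=
  spread_support a b s1 s2 La ab bU s10 ltac:(lra) ltac:(lra) s2UL ULne.
apply: (three_points _ _ c (length J) s1 s2) => //; try exact: ltW.
- by rewrite mE JE; apply: le_trans G1 _; rewrite /F1 -E1; exact: Fle.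
- by rewrite mE JE; apply: le_trans G2 _; rewrite /F2 -E2; exact: Fle.
Qed.

End Spread.

Lemma monotone_on_betw (R : realType) (I : set R) (psi : R -> R) :
  monotone_on I psi -> forall x y z, I x -> I y -> I z -> x <= y -> y <= z ->
  (psi x - psi y) ^+ 2 <= (psi x - psi z) ^+ 2 /\
  (psi y - psi z) ^+ 2 <= (psi x - psi z) ^+ 2.
Proof.
move=> hmono x y z Ix Iy Iz xy yz.
have [xI yI zI] : [/\ x \in I, y \in I & z \in I] by rewrite !inE.
by case: hmono => mono; have := mono _ _ xI yI xy; have := mono _ _ yI zI yz;
  move=> h1 h2; split; nra.
Qed.

Theorem proposition1p4 (R : realType) (I : set R) (psi : R -> R)
    (hI : finite_interval I) (hmono : monotone_on I psi) (hVMO : VMO I psi) :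
  convex_function (E := R^o) `[0, length I]%classic
    (fun t : R => t ^+ 2 * xi I psi t ^+ 2).
Proof.
have [L [U [LU LUI ILU]]] := finite_interval_endpoints _ hI.
have [hL2 _] := hVMO.
have conv := scaled_xi_convex _ _ hI hL2 _ _ LUI ILU (monotone_on_betw _ _ _ hmono).
have IE : length I = U - L by exact: length_I.
move=> p x y; rewrite !inE /= !in_itv /= IE => /andP[x0 xl] /andP[y0 yl].
rewrite convRE.
(* [scaled_xi_convex] wants the endpoints in order; otherwise the weights are
   exchanged. *)
have [xy|/ltW yx] := leP x y.
  exact: (conv x y _ p%:num).
rewrite [leRHS]addrC.
have := conv y x (convex.conv p x y) (1 - p%:num) hVMO y0 yx xl.
rewrite subKr; apply; first by rewrite subr_ge0.
  by rewrite gerBl.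
exact: addrC.
Qed.
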